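(* Assume $\mathcal Y\neq\emptyset$, $A$ has full row rank $m$, $Z^TQZ\succ 0$, the quadratic program has an optimal solution $y^*$ with multipliers $\lambda^*$ for the bound constraints, and the matrix $[R\;\;E^*]$ has full column rank. Let $\{(y^k,w^k,\lambda^k)\}$ be generated by the ADMM iteration. Then for every $k$ such that $\mathcal A^k\subseteq\mathcal A^*$, $$\|v^{k+1}-v^*\|\le \delta(\|M_Z\|,c_F^*,\alpha^k)\,\|v^k-v^*\|,$$ with convergence rate $\delta(\|M_Z\|,c_F^*,\alpha^k)<1$, where $\alpha^k\le 1$.
   Context: Problem. Let $Q\in\mathbb R^{n\times n}$ be symmetric positive semidefinite, $q\in\mathbb R^n$, $A\in\mathbb R^{m\times n}$, $b\in\mathbb R^m$, and $\mathcal Y=\{y\in\mathbb R^n:\underline y_i\le y_i\le\overline y_i\ \forall i\}$ with $-\infty\le\underline y_i<\overline y_i\le\infty$. The quadratic program (QP) is: minimize $q^Ty+\frac12 y^TQy$ subject to $Ay=b$, $y\in\mathcal Y$. Norms are Euclidean norms of vectors and spectral norms of matrices (the norm of a matrix with no columns is $0$). Notation. $\lambda\perp x\in\mathcal Y$ means $x\in\mathcal Y$ and $\lambda^T(x'-x)\ge0$ for all $x'\in\mathcal Y$. $R\in\mathbb R^{n\times m}$ and $Z\in\mathbb R^{n\times(n-m)}$ have columns forming orthonormal bases of the range of $A^T$ and of the null space of $A$. $\mathbb P_{\mathcal Y}$ is Euclidean projection onto $\mathcal Y$. Fix $\beta>0$, put $\tilde q=q/\beta$ and $$M=Z\big(Z^T(Q/\beta+I_n)Z\big)^{-1}Z^T,\quad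 N=(I_n-MQ/\beta)R(AR)^{-1},\quad M_Z=2(Z^TQZ/\beta+I_{n-m})^{-1}-I_{n-m}.$$ ADMM iteration, from arbitrary $w^0,\lambda^0\in\mathbb R^n$, for $k\ge0$: $y^{k+1}=M(w^k+\lambda^k-\tilde q)+Nb$, $w^{k+1}=\mathbb P_{\mathcal Y}(y^{k+1}-\lambda^k)$, $\lambda^{k+1}=\lambda^k+w^{k+1}-y^{k+1}$. Put $v^k=y^{k+1}-\lambda^k$ for $k\ge 0$. Solution. $y^*$ is an optimal solution with multipliers $\lambda^*\in\mathbb R^n$ for the bound constraints if for some $\xi^*\in\mathbb R^m$: $Qy^*+A^T\xi^*-\lambda^*=-q$, $Ay^*=b$, $\lambda^*\perp y^*\in\mathcal Y$. Put $v^*=y^*-\lambda^*/\beta$. $\mathcal A^*=\{i: y_i^*=\underline y_i\text{ or }y_i^*=\overline y_i\}$; $E^*$ is the matrix whose columns are the unit vectors $e_i$, $i\in\mathcal A^*$; $c_F^*=\|R^TE^*\|$. Iteration quantities. $\mathcal A^k=\{i:\lambda_i^{k+1}\ne\lambda_i^*/\beta\}$. $\alpha^k=\|\lambda^{k+1}-\lambda^*/\beta\|/\|v^k-v^*\|$ (with $\alpha^k:=0$ if $v^k=v^*$). Contraction factor. For $\kappa\ge 0$, $c\in[0,1]$, $\alpha^{\max}\in[0,1]$, $\delta(\kappa,c,\alpha^{\max})\ge0$ is defined by $$\delta(\kappa,c,\alpha^{\max})^2=\sup_{\zeta_u,\zeta_v,\alpha,\gamma}\ \tfrac14\big((\kappa\zeta_u+\zeta_v)^2+\gamma^2\big)$$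 subject to $(\zeta_u+\zeta_v)^2\ge4(1-c^2)\alpha^2$, $\gamma^2\le4c^2\alpha^2$, $\gamma^2\le\big(\sqrt{1-\zeta_u^2}+\sqrt{1-\zeta_v^2}\big)^2$, $0\le\zeta_u,\zeta_v\le1$, $0\le\alpha\le\alpha^{\max}$. *)

(* Defs.v *)
From HB Require Import structures.
From mathcomp Require Import all_boot all_order all_algebra.
From mathcomp Require Import all_classical all_reals.

Set Implicit Arguments.
Unset Strict Implicit.
Unset Printing Implicit Defensive.

Import Order.TTheory GRing.Theory Num.Theory.

Local Open Scope classical_set_scope.
Local Open Scope ring_scope.

(* In MathComp-Analysis `|x| is the max norm on matrices, hence an explicit
   Euclidean norm. *)
Definition l2norm (K : realType) (n : nat) (x : 'cV[K]_n) : K :=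
  Num.sqrt (\sum_i x i 0 ^+ 2).

Definition specnorm (K : realType) (p n : nat) (B : 'M[K]_(p, n)) : K :=
  sup [set l2norm (B *m x) | x in [set x : 'cV[K]_n | l2norm x <= 1]].

Definition dotcv (K : realType) (n : nat) (x y : 'cV[K]_n) : K :=
  (x^T *m y) 0 0.

Definition possemidef (K : realType) (n : nat) (B : 'M[K]_n) : Prop :=
  forall x : 'cV[K]_n, 0 <= dotcv x (B *m x).

Definition posdef (K : realType) (n : nat) (B : 'M[K]_n) : Prop :=
  forall x : 'cV[K]_n, x != 0 -> 0 < dotcv x (B *m x).

(* The columns of B form an orthonormal basis of the row space of S. *)
Definition orthonormal_basis (K : realType) (n p s : nat)
    (B : 'M[K]_(n, p)) (S : 'M[K]_(s, n)) : Prop :=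
  B^T *m B = 1%:M /\ (B^T :=: S)%MS.

Definition box (K : realType) (n : nat) (lo up : 'I_n -> \bar K) :
    set 'cV[K]_n :=
  [set y | forall i, (lo i <= (y i 0)%:E)%E /\ ((y i 0)%:E <= up i)%E].

Definition is_proj (K : realType) (n : nat) (Y : set 'cV[K]_n)
    (x p : 'cV[K]_n) : Prop :=
  Y p /\ forall z, Y z -> l2norm (x - p) <= l2norm (x - z).

(* The default value 0 is only returned when no nearest point exists. *)
Definition proj (K : realType) (n : nat) (Y : set 'cV[K]_n)
    (x : 'cV[K]_n) : 'cV[K]_n :=
  xget 0 [set p | is_proj Y x p].

Definition complementary (K : realType) (n : nat) (Y : set 'cV[K]_n)
    (lam x : 'cV[K]_n) : Prop :=
  Y x /\ forall x', Y x' -> 0 <= dotcv lam (x' - x).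

(* y is optimal for
     minimize q^T y + 1/2 y^T Q y  subject to  A y = b, y \in Y
   with multipliers lam for the constraint y \in Y. *)
Definition qp_solution (K : realType) (m n : nat) (Q : 'M[K]_n)
    (q : 'cV[K]_n) (A : 'M[K]_(m, n)) (b : 'cV[K]_m) (Y : set 'cV[K]_n)
    (y lam : 'cV[K]_n) : Prop :=
  exists xi : 'cV[K]_m,
    [/\ Q *m y + A^T *m xi - lam = - q, A *m y = b & complementary Y lam y].

Definition active (K : realType) (n : nat) (lo up : 'I_n -> \bar K)
    (y : 'cV[K]_n) : {set 'I_n} :=
  [set i | ((y i 0)%:E == lo i) || ((y i 0)%:E == up i)]%SET.

Definition unit_cols (K : realType) (n : nat) (S : {set 'I_n}) :
    'M[K]_(n, #|S|) :=
  \matrix_(i, j) (i == enum_val j)%:R.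

Definition admm_M (K : realType) (n p : nat) (Q : 'M[K]_n)
    (Z : 'M[K]_(n, p)) (beta : K) : 'M[K]_n :=
  Z *m invmx (Z^T *m (beta^-1 *: Q + 1%:M) *m Z) *m Z^T.

Definition admm_N (K : realType) (m n p : nat) (Q : 'M[K]_n)
    (A : 'M[K]_(m, n)) (R : 'M[K]_(n, m)) (Z : 'M[K]_(n, p)) (beta : K) :
    'M[K]_(n, m) :=
  (1%:M - admm_M Q Z beta *m (beta^-1 *: Q)) *m R *m invmx (A *m R).

Definition admm_MZ (K : realType) (n p : nat) (Q : 'M[K]_n)
    (Z : 'M[K]_(n, p)) (beta : K) : 'M[K]_p :=
  2 *: invmx (beta^-1 *: (Z^T *m Q *m Z) + 1%:M) - 1%:M.

(* The value y 0 is irrelevant. *)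
Definition admm_iteration (K : realType) (m n p : nat) (Q : 'M[K]_n)
    (q : 'cV[K]_n) (A : 'M[K]_(m, n)) (b : 'cV[K]_m) (Y : set 'cV[K]_n)
    (R : 'M[K]_(n, m)) (Z : 'M[K]_(n, p)) (beta : K)
    (y w lam : nat -> 'cV[K]_n) : Prop :=
  forall k : nat,
    [/\ y k.+1 = admm_M Q Z beta *m (w k + lam k - beta^-1 *: q)
                 + admm_N Q A R Z beta *m b,
        w k.+1 = proj Y (y k.+1 - lam k)
      & lam k.+1 = lam k + w k.+1 - y k.+1].

Definition admm_v (K : realType) (n : nat) (y lam : nat -> 'cV[K]_n)
    (k : nat) : 'cV[K]_n :=
  y k.+1 - lam k.

(* The iterates lam k are scaled by 1/beta relative to the multipliers. *)
Definition vstar (K : realType) (n : nat) (beta : K) (ys lams : 'cV[K]_n) :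
    'cV[K]_n :=
  ys - beta^-1 *: lams.

Definition active_iter (K : realType) (n : nat) (beta : K)
    (lams : 'cV[K]_n) (lam : nat -> 'cV[K]_n) (k : nat) : {set 'I_n} :=
  [set i | lam k.+1 i 0 != lams i 0 / beta]%SET.

Definition alpha_iter (K : realType) (n : nat) (beta : K)
    (ys lams : 'cV[K]_n) (y lam : nat -> 'cV[K]_n) (k : nat) : K :=
  if admm_v y lam k == vstar beta ys lams then 0
  else l2norm (lam k.+1 - beta^-1 *: lams)
       / l2norm (admm_v y lam k - vstar beta ys lams).

Definition delta_feasible (K : realType) (c amax zu zv alpha gamma : K) :
    Prop :=
  [/\ (zu + zv) ^+ 2 >= 4 * (1 - c ^+ 2) * alpha ^+ 2,
      gamma ^+ 2 <= 4 * c ^+ 2 * alpha ^+ 2,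
      gamma ^+ 2 <= (Num.sqrt (1 - zu ^+ 2) + Num.sqrt (1 - zv ^+ 2)) ^+ 2,
      0 <= zu <= 1 /\ 0 <= zv <= 1
    & 0 <= alpha <= amax].

(* For kappa >= 0 and c, amax in [0, 1] the set below is nonempty (take all
   variables 0) and bounded, so sup is the true supremum. *)
Definition delta (K : realType) (kappa c amax : K) : K :=
  Num.sqrt (sup [set t | exists zu zv alpha gamma : K,
    delta_feasible c amax zu zv alpha gamma /\
    t = 4^-1 * ((kappa * zu + zv) ^+ 2 + gamma ^+ 2)]).

(* Main.v *)
(* Put dv = v^k - v^*, dw = w^{k+1} - y^*, dl = lambda^{k+1} - lambda^*/beta and
   u = dw + dl. The KKT conditions make (y^*, lambda^*/beta) a fixed point of the
   iteration, whence dv = dw - dl and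
     v^{k+1} - v^* = ((2M - I) u + dv) / 2,   2M - I = Z M_Z Z^T - R R^T.
   Splitting along the ranges of Z and R gives
     4 |v^{k+1} - v^*|^2 = |M_Z Z^T u + Z^T dv|^2 + |2 R^T dl|^2.
   The variational inequality of the projection gives dw^T dl <= 0, so |u| <= |dv|
   and |dl| <= |dv|, and (|Z^T u|, |Z^T dv|, |dl|, 2 |R^T dl|) / |dv| is feasible
   in the problem that defines delta. Strictness delta < 1 follows from the
   explicit bound delta^2 <= 1 - (1 - kappa) (1 - c^2) / 16. *)
Require Import Defs.
From HB Require Import structures.
From mathcomp Require Import all_boot all_order all_algebra.
From mathcomp Require Import all_classical all_reals.
From mathcomp Require Import ring lra.

Set Implicit Arguments.
Unset Strict Implicit.
Unset Printing Implicit Defensive.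

Import Order.TTheory GRing.Theory Num.Theory.

Local Open Scope classical_set_scope.
Local Open Scope ring_scope.

(** * Inner product and Euclidean norm on column vectors *)

Section DotProduct.
Variable K : realType.

Lemma dotcvE (n : nat) (x y : 'cV[K]_n) : dotcv x y = \sum_i x i 0 * y i 0.
Proof. by rewrite /dotcv mxE; apply: eq_bigr => i _; rewrite mxE. Qed.

Lemma dotcvC (n : nat) (x y : 'cV[K]_n) : dotcv x y = dotcv y x.
Proof. by rewrite !dotcvE; apply: eq_bigr => i _; rewrite mulrC. Qed.

Lemma dotcvDr (n : nat) (x y z : 'cV[K]_n) :
  dotcv x (y + z) = dotcv x y + dotcv x z.
Proof. by rewrite /dotcv mulmxDr mxE. Qed.

Lemma dotcvDl (n : nat) (x y z : 'cV[K]_n) :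
  dotcv (y + z) x = dotcv y x + dotcv z x.
Proof. by rewrite dotcvC dotcvDr !(dotcvC x). Qed.

Lemma dotcvZr (n : nat) (a : K) (x y : 'cV[K]_n) :
  dotcv x (a *: y) = a * dotcv x y.
Proof. by rewrite /dotcv -scalemxAr mxE. Qed.

Lemma dotcvZl (n : nat) (a : K) (x y : 'cV[K]_n) :
  dotcv (a *: y) x = a * dotcv y x.
Proof. by rewrite dotcvC dotcvZr dotcvC. Qed.

Lemma dotcvNr (n : nat) (x y : 'cV[K]_n) : dotcv x (- y) = - dotcv x y.
Proof. by rewrite -scaleN1r dotcvZr mulN1r. Qed.

Lemma dotcvNl (n : nat) (x y : 'cV[K]_n) : dotcv (- y) x = - dotcv y x.
Proof. by rewrite dotcvC dotcvNr dotcvC. Qed.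

Definition dotcv_linear :=
  (dotcvDr, dotcvDl, dotcvNr, dotcvNl, dotcvZr, dotcvZl).

Lemma dotcv_subsub (n : nat) (x y : 'cV[K]_n) :
  dotcv (x - y) (x - y) = dotcv x x + dotcv y y - 2 * dotcv x y.
Proof. by rewrite !dotcv_linear (dotcvC y x); ring. Qed.

Lemma dotcv_mulmxl (n p : nat) (B : 'M[K]_(p, n)) (x : 'cV_p) (y : 'cV_n) :
  dotcv (B^T *m x) y = dotcv x (B *m y).
Proof. by rewrite /dotcv trmx_mul trmxK mulmxA. Qed.

Lemma dotcv_ge0 (n : nat) (x : 'cV[K]_n) : 0 <= dotcv x x.
Proof. by rewrite dotcvE sumr_ge0 // => i _; rewrite -expr2 sqr_ge0. Qed.

Lemma dotcv_eq0 (n : nat) (x : 'cV[K]_n) : (dotcv x x == 0) = (x == 0).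
Proof.
apply/eqP/eqP => [|->]; last first.
  by rewrite dotcvE big1 // => i _; rewrite mxE mul0r.
rewrite dotcvE => /eqP; rewrite psumr_eq0; last first.
  by move=> i _; rewrite -expr2 sqr_ge0.
move=> /allP x0; apply/colP => i; rewrite mxE; apply/eqP.
by have := x0 i (mem_index_enum i); rewrite -expr2 sqrf_eq0.
Qed.

Lemma l2normE (n : nat) (x : 'cV[K]_n) : l2norm x = Num.sqrt (dotcv x x).
Proof.
by rewrite /l2norm dotcvE; congr Num.sqrt; apply: eq_bigr => i _; rewrite expr2.
Qed.

Lemma sqr_l2norm (n : nat) (x : 'cV[K]_n) : l2norm x ^+ 2 = dotcv x x.
Proof. by rewrite l2normE sqr_sqrtr // dotcv_ge0. Qed.

Lemma l2norm_ge0 (n : nat) (x : 'cV[K]_n) : 0 <= l2norm x.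
Proof. exact: sqrtr_ge0. Qed.

Lemma l2norm_eq0 (n : nat) (x : 'cV[K]_n) : (l2norm x == 0) = (x == 0).
Proof. by rewrite -sqrf_eq0 sqr_l2norm dotcv_eq0. Qed.

Lemma l2normZ (n : nat) (a : K) (x : 'cV[K]_n) :
  0 <= a -> l2norm (a *: x) = a * l2norm x.
Proof.
move=> a0; rewrite !l2normE dotcvZl dotcvZr mulrA sqrtrM ?mulr_ge0 //.
by rewrite -expr2 sqrtr_sqr ger0_norm.
Qed.

Lemma l2normN (n : nat) (x : 'cV[K]_n) : l2norm (- x) = l2norm x.
Proof. by rewrite !l2normE dotcvNl dotcvNr opprK. Qed.

Lemma possemidef_Cauchy_Schwarz (n : nat) (B : 'M[K]_n) (x y : 'cV[K]_n) :
  B^T = B -> possemidef B ->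
  dotcv x (B *m y) ^+ 2 <= dotcv x (B *m x) * dotcv y (B *m y).
Proof.
move=> Bsym Bpsd.
have symB : dotcv y (B *m x) = dotcv x (B *m y).
  by rewrite -dotcv_mulmxl Bsym dotcvC.
have expand (s t : K) : 0 <= s ^+ 2 * dotcv x (B *m x)
    + 2 * s * t * dotcv x (B *m y) + t ^+ 2 * dotcv y (B *m y).
  have := Bpsd (s *: x + t *: y).
  rewrite mulmxDr -!scalemxAr !dotcv_linear symB; lra.
have := Bpsd x; have := Bpsd y.
set a := dotcv x (B *m x) in expand *; set b := dotcv x (B *m y) in expand *.
set c := dotcv y (B *m y) in expand * => c0 a0.
(* The first two choices give [c * (a * c - b ^+ 2) >= 0] and [a * (a * c - b ^+ 2) >= 0]; the third
   reads [- 2 * b ^+ 2 >= 0] in the degenerate case [a = c = 0]. *)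
have := expand c (- b); have := expand (- b) a; have := expand 1 (- b).
move=> h1 h2 h3.
have [c_pos|c_le0] := ltP 0 c.
  rewrite -subr_ge0 -(pmulr_rge0 _ c_pos); lra.
have c_eq0 : c = 0 by apply/eqP; rewrite eq_le c_le0 c0.
have [a_pos|a_le0] := ltP 0 a.
  rewrite -subr_ge0 -(pmulr_rge0 _ a_pos); lra.
have a_eq0 : a = 0 by apply/eqP; rewrite eq_le a_le0 a0.
move: h1; rewrite a_eq0 c_eq0; lra.
Qed.

Lemma Cauchy_Schwarz_l2norm (n : nat) (x y : 'cV[K]_n) :
  dotcv x y <= l2norm x * l2norm y.
Proof.
have := @possemidef_Cauchy_Schwarz n 1%:M x y (trmx1 _ _).
rewrite !mul1mx -!sqr_l2norm -exprMn => CS.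
have {}CS := CS (fun z => ltac:(by rewrite mul1mx dotcv_ge0)).
have := mulr_ge0 (l2norm_ge0 x) (l2norm_ge0 y) => h0.
apply: le_trans (ler_norm _) _.
by rewrite -(ler_pXn2r (n := 2)) ?nnegrE // real_normK ?num_real.
Qed.

Lemma l2norm_triangle (n : nat) (x y : 'cV[K]_n) :
  l2norm (x + y) <= l2norm x + l2norm y.
Proof.
rewrite -(ler_pXn2r (n := 2)) ?nnegrE ?addr_ge0 ?l2norm_ge0 //.
rewrite sqrrD !sqr_l2norm !dotcv_linear (dotcvC y x).
have := Cauchy_Schwarz_l2norm x y; lra.
Qed.

End DotProduct.

(** * Spectral norm, coercivity and strict norm bounds *)

Section SpectralNorm.
Variable K : realType.

(** Cauchy-Schwarz on each row gives the Frobenius norm as constant; later uses only need some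
    finite bound. *)
Lemma l2norm_mulmx_bound (p n : nat) (B : 'M[K]_(p, n)) :
  exists2 C, 0 <= C & forall x, l2norm (B *m x) <= C * l2norm x.
Proof.
pose C := \sum_i dotcv (row i B)^T (row i B)^T.
have C0 : 0 <= C by apply: sumr_ge0 => i _; exact: dotcv_ge0.
exists (Num.sqrt C) => [|x]; first exact: sqrtr_ge0.
rewrite !l2normE -sqrtrM // ler_sqrt ?mulr_ge0 ?dotcv_ge0 //.
rewrite /C mulr_suml dotcvE; apply: ler_sum => i _.
have -> : (B *m x) i 0 = dotcv (row i B)^T x.
  by rewrite /dotcv trmxK -row_mul [RHS]mxE.
rewrite -expr2 -!sqr_l2norm -exprMn.
have h0 := mulr_ge0 (l2norm_ge0 (row i B)^T) (l2norm_ge0 x).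
rewrite -[leLHS]real_normK ?num_real // ler_pXn2r ?nnegrE //.
rewrite ler_norml Cauchy_Schwarz_l2norm andbT lerNl -dotcvNl.
by rewrite -(l2normN (row i B)^T) Cauchy_Schwarz_l2norm.
Qed.

(** [sup] is a true supremum only on nonempty sets bounded above, so the estimates on [specnorm]
    rest on this. *)
Lemma specnorm_has_sup (p n : nat) (B : 'M[K]_(p, n)) :
  has_sup [set l2norm (B *m x) | x in [set x : 'cV[K]_n | l2norm x <= 1]].
Proof.
split.
  exists (l2norm (B *m 0)), 0 => //=; apply: le_trans ler01.
  by rewrite le_eqVlt l2norm_eq0 eqxx.
have [C C0 BC] := l2norm_mulmx_bound B.
exists C => _ [z /= z1 <-]; apply: le_trans (BC z) _.
by rewrite -[leRHS]mulr1 ler_wpM2l.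
Qed.

Lemma l2norm_mulmx_le (p n : nat) (B : 'M[K]_(p, n)) (x : 'cV_n) :
  l2norm (B *m x) <= specnorm B * l2norm x.
Proof.
have [->|x0] := eqVneq x 0.
  have -> : l2norm (0 : 'cV[K]_n) = 0 by apply/eqP; rewrite l2norm_eq0.
  by rewrite mulmx0 mulr0 le_eqVlt l2norm_eq0 eqxx.
have nx : 0 < l2norm x by rewrite lt_def l2norm_ge0 l2norm_eq0 x0.
rewrite -ler_pdivrMr // mulrC -l2normZ ?invr_ge0 ?l2norm_ge0 // scalemxAr.
apply: ub_le_sup; first by have [] := specnorm_has_sup B.
exists ((l2norm x)^-1 *: x) => //=.
by rewrite l2normZ ?invr_ge0 ?l2norm_ge0 // mulVf ?gt_eqF.
Qed.

Lemma specnorm_ge0 (p n : nat) (B : 'M[K]_(p, n)) : 0 <= specnorm B.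
Proof.
have [[z zS] ub] := specnorm_has_sup B.
have z0 : 0 <= z by case: zS => x _ <-; exact: l2norm_ge0.
by apply: le_trans z0 _; apply: ub_le_sup.
Qed.

Lemma posdef_unitmx (n : nat) (B : 'M[K]_n) : posdef B -> B \in unitmx.
Proof.
move=> Bpd; rewrite -unitmx_tr -row_free_unit -kermx_eq0.
apply/eqP/row_matrixP => i; rewrite row0.
have : row i (kermx B^T) *m B^T = 0 by apply/sub_kermxP; exact: row_sub.
move: (row i _) => r; move/(congr1 trmx); rewrite trmx_mul trmxK trmx0 => Br0.
apply/eqP/negPn/negP => r0; have := Bpd r^T.
by rewrite Br0 trmx_eq0 r0 /dotcv mulmx0 mxE ltxx => /(_ isT).
Qed.

(* Cauchy-Schwarz for the form [x^T B y], applied to [x] and [B^-1 x], gives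
   [|x|^4 <= (x^T B x) (x^T B^-1 x)]; this replaces a compactness argument. *)
Lemma posdef_coercive (n : nat) (B : 'M[K]_n) : B^T = B -> posdef B ->
  exists2 mu, 0 < mu & forall x, mu * dotcv x x <= dotcv x (B *m x).
Proof.
move=> Bsym Bpd; have Bu := posdef_unitmx Bpd.
have Bpsd : possemidef B.
  move=> x; have [->|/Bpd/ltW//] := eqVneq x 0.
  by rewrite /dotcv !mulmx0 mxE.
have [C C0 BC] := l2norm_mulmx_bound (invmx B).
have C1 : 0 < C + 1 by lra.
exists (C + 1)^-1 => [|x]; first by rewrite invr_gt0.
have [->|x0] := eqVneq x 0; first by rewrite /dotcv !mulmx0 mxE mulr0.
have xx : 0 < dotcv x x by rewrite lt_def dotcv_ge0 dotcv_eq0 x0.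
have := @possemidef_Cauchy_Schwarz K n B x (invmx B *m x) Bsym Bpsd.
rewrite mulKVmx // => CS.
have : dotcv (invmx B *m x) x <= (C + 1) * dotcv x x.
  apply: le_trans (Cauchy_Schwarz_l2norm _ _) _.
  have := ler_wpM2r (l2norm_ge0 x) (BC x).
  have := sqr_l2norm x; have := dotcv_ge0 x; nra.
move=> h; rewrite mulrC ler_pdivrMr // -(ler_pM2l xx) -expr2.
apply: le_trans CS _.
have := ler_wpM2l (ltW (Bpd _ x0)) h; lra.
Qed.

(** Coercivity of [1 - B^T B] turns pointwise strictness into the uniform bound
    [|B x|^2 <= (1 - mu) |x|^2]. *)
Lemma specnorm_lt1 (p n : nat) (B : 'M[K]_(p, n)) :
  (forall x : 'cV_n, x != 0 -> dotcv (B *m x) (B *m x) < dotcv x x) ->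
  specnorm B < 1.
Proof.
move=> Blt; pose G : 'M[K]_n := 1%:M - B^T *m B.
have GE x : dotcv x (G *m x) = dotcv x x - dotcv (B *m x) (B *m x).
  rewrite /G mulmxBl mul1mx dotcvDr dotcvNr -mulmxA; congr (_ - _).
  by rewrite dotcvC dotcv_mulmxl.
have Gsym : G^T = G by rewrite /G linearB /= trmx1 trmx_mul trmxK.
have Gpd : posdef G by move=> x /Blt; rewrite GE subr_gt0.
have [mu mu0 Gmu] := posdef_coercive Gsym Gpd.
apply: (@le_lt_trans _ _ (Num.sqrt (1 - mu))); last first.
  by rewrite -[ltRHS]sqrtr1 ltr_sqrt //; lra.
apply: ge_sup; first by have [] := specnorm_has_sup B.
move=> _ [x /= x1 <-].
apply: (@le_trans _ _ (l2norm x * Num.sqrt (1 - mu))); last first.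
  by rewrite -[leRHS]mul1r ler_wpM2r // sqrtr_ge0.
rewrite !l2normE -sqrtrM ?dotcv_ge0 // ler_wsqrtr //.
have := Gmu x; rewrite GE; lra.
Qed.

End SpectralNorm.

(** * Projection onto a box with possibly infinite bounds *)

Section Projection.
Variable K : realType.

(** The witness clamps [x] to the interval: it is [x] itself or the endpoint that [x] lies beyond,
    which is then finite. *)
Lemma interval_clamp (lo up : \bar K) (x z0 : K) :
  (lo < up)%E -> (lo <= z0%:E)%E -> (z0%:E <= up)%E ->
  exists c : K, [/\ (lo <= c%:E)%E, (c%:E <= up)%E &
    forall z : K, (lo <= z%:E)%E -> (z%:E <= up)%E -> (x - c) * (z - c) <= 0].
Proof.
move=> loup loz zup.
have [lox|xlo] := leP lo x%:E; last first.
  case: lo loup loz xlo => [r| |] // loup loz; rewrite lte_fin => xr.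
  exists r; split=> [||z]; [by []|exact: ltW|].
  rewrite lee_fin => rz _; apply: mulr_le0_ge0; lra.
have [xup|upx] := leP x%:E up.
  by exists x; split=> // z _ _; rewrite subrr mul0r.
case: up loup zup upx => [r| |] // loup zup; rewrite lte_fin => rx.
exists r; split=> [||z]; [exact: ltW|by []|].
rewrite lee_fin => _ zr; apply: mulr_ge0_le0; lra.
Qed.

(** A box is a product of intervals, so clamping each coordinate gives a point satisfying the
    inequality term by term. That point is the unique nearest one, hence the value picked by
    [xget]. *)
Lemma proj_box_variational (n : nat) (lo up : 'I_n -> \bar K) (x : 'cV[K]_n) :
  (forall i, (lo i < up i)%E) -> box lo up !=set0 ->
  box lo up (Defs.proj (box lo up) x) /\
  forall z, box lo up z ->
    dotcv (x - Defs.proj (box lo up) x) (z - Defs.proj (box lo up) x) <= 0.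
Proof.
move=> loup [z0 z0box].
have /choice[f fP] : forall i, exists c : K, [/\ (lo i <= c%:E)%E,
    (c%:E <= up i)%E & forall z : K, (lo i <= z%:E)%E -> (z%:E <= up i)%E ->
    (x i 0 - c) * (z - c) <= 0].
  by move=> i; have [? ?] := z0box i; apply: (interval_clamp _ (loup i)); eauto.
pose c : 'cV[K]_n := \col_i f i.
have cbox : box lo up c by move=> i; rewrite mxE; have [] := fP i.
have cVI z : box lo up z -> dotcv (x - c) (z - c) <= 0.
  move=> zb; rewrite dotcvE; apply: sumr_le0 => i _; rewrite !mxE.
  by have [_ _] := fP i; have [? ?] := zb i; apply.
have pyth z : dotcv (x - z) (x - z) =
    dotcv (x - c) (x - c) + dotcv (z - c) (z - c) - 2 * dotcv (x - c) (z - c).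
  by rewrite -dotcv_subsub opprB addrA subrK.
have cproj : is_proj (box lo up) x c.
  split=> // z zb; rewrite !l2normE ler_wsqrtr // (pyth z).
  move: (cVI z zb) (dotcv_ge0 (z - c)); lra.
have [pbox pmin] : is_proj (box lo up) x (Defs.proj (box lo up) x).
  by rewrite /Defs.proj; apply: (xgetPex 0); exists c.
(* Uniqueness: if [p] is at least as near to [x] as [c], then [pyth] gives
   [|p - c|^2 <= 2 (x - c)^T (p - c) <= 0]. *)
have : Defs.proj (box lo up) x - c = 0.
  apply/eqP; rewrite -dotcv_eq0 eq_le dotcv_ge0 andbT.
  have := pmin c cbox; rewrite -(ler_pXn2r (n := 2)) ?nnegrE ?l2norm_ge0 //.
  rewrite !sqr_l2norm pyth; have := cVI _ pbox; lra.
by move/eqP; rewrite subr_eq0 => /eqP->; split.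
Qed.

End Projection.

(** * Bounds on the contraction factor *)

Section ContractionFactor.
Variable K : realType.

(* Write [a = zu], [b = zv]. Without its third constraint the objective is at
   most [(a + b)^2 / (1 - c^2)]; that constraint alone bounds it by
   [4 - (a - b)^2 - (1 - kappa) a^2]. One of the two is at most the claim. *)
Lemma delta_objective_bound (kappa c amax zu zv alpha gamma : K) :
  0 <= kappa < 1 -> 0 <= c < 1 -> delta_feasible c amax zu zv alpha gamma ->
  4^-1 * ((kappa * zu + zv) ^+ 2 + gamma ^+ 2)
    <= 1 - (1 - kappa) * (1 - c ^+ 2) / 16.
Proof.
move=> /andP[k0 k1] /andP[c0 c1] [h1 h2 h3 [/andP[a0 a1] /andP[b0 b1]] _].
have c2 : 0 <= c ^+ 2 < 1 by rewrite sqr_ge0 /= expr_lt1.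
have /andP[c20 c21] := c2.
have ka : (kappa * zu + zv) ^+ 2 <= (zu + zv) ^+ 2 - (1 - kappa) * zu ^+ 2.
  have : 0 <= (1 - kappa) * (zu * (kappa * zu + 2 * zv)).
    apply: mulr_ge0; first lra.
    by rewrite mulr_ge0 // addr_ge0 ?mulr_ge0.
  lra.
have bnd0 : 0 <= (1 - kappa) * (1 - c ^+ 2) <= 1.
  apply/andP; split; first by rewrite mulr_ge0 ?subr_ge0 ?ltW.
  by apply: mulr_ile1; lra.
(* Below this threshold, eliminating [alpha] from the first two constraints gives
   [(zu + zv)^2 + gamma^2 <= 2], so the objective is at most 1/2. *)
have [small|large] := leP ((zu + zv) ^+ 2) (2 * (1 - c ^+ 2)).
  have : (1 - c ^+ 2) * gamma ^+ 2 <= c ^+ 2 * (zu + zv) ^+ 2.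
    have := ler_wpM2l c20 h1.
    have : 0 <= 1 - c ^+ 2 by lra.
    move=> /ler_wpM2l /(_ _ _ h2); lra.
  move=> g.
  have : (zu + zv) ^+ 2 + gamma ^+ 2 <= 2.
    have : 0 < 1 - c ^+ 2 by lra.
    move=> p; rewrite -(ler_pM2l p); lra.
  have : 0 <= (1 - kappa) * zu ^+ 2 by apply: mulr_ge0; [lra|exact: sqr_ge0].
  move: bnd0 => /andP[]; lra.
set s := Num.sqrt (1 - zu ^+ 2) in h3; set t := Num.sqrt (1 - zv ^+ 2) in h3.
have s2 : s ^+ 2 = 1 - zu ^+ 2 by rewrite sqr_sqrtr // subr_ge0 expr_le1.
have t2 : t ^+ 2 = 1 - zv ^+ 2 by rewrite sqr_sqrtr // subr_ge0 expr_le1.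
have obj : (kappa * zu + zv) ^+ 2 + gamma ^+ 2
    <= 4 - (zu - zv) ^+ 2 - (1 - kappa) * zu ^+ 2.
  have := sqr_ge0 (s - t); lra.
(* Write [zu + zv = 2 zu + (zv - zu)]. Above the threshold this forces
   [1 - c^2 <= 4 zu^2 + (zu - zv)^2]; the 4 here and the [4^-1] of the objective make the 16. *)
have : (zu + zv) ^+ 2 <= 8 * zu ^+ 2 + 2 * (zu - zv) ^+ 2.
  have := sqr_ge0 (2 * zu - (zv - zu)); lra.
have k1' : 0 <= 1 - kappa by lra.
move=> /(le_trans (ltW large)) h; have := ler_wpM2l k1' h.
have : 0 <= kappa * (zu - zv) ^+ 2 by rewrite mulr_ge0 ?sqr_ge0.
have := sqr_ge0 (zu - zv); lra.
Qed.

Lemma delta_lt1 (kappa c amax : K) :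
  0 <= kappa < 1 -> 0 <= c < 1 -> 0 <= amax -> delta kappa c amax < 1.
Proof.
move=> k01 c01 amax0.
apply: (@le_lt_trans _ _ (Num.sqrt (1 - (1 - kappa) * (1 - c ^+ 2) / 16))).
  apply: ler_wsqrtr; apply: ge_sup.
    exists (4^-1 * ((kappa * 0 + 0) ^+ 2 + 0 ^+ 2)), 0, 0, 0, 0; split=> //.
    by split; rewrite ?lexx ?ler01 ?amax0 ?addr0 ?expr0n ?mulr0 // sqr_ge0.
  by move=> _ [zu [zv [al [ga [feas ->]]]]]; exact: delta_objective_bound feas.
rewrite -[ltRHS]sqrtr1 ltr_sqrt // gtrBl divr_gt0 //.
case/andP: k01 => _ ?; case/andP: c01 => c0 ?.
by rewrite mulr_gt0 ?subr_gt0 // expr_lt1.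
Qed.

(** The explicit bound on the objective also shows that the set under [sup] is bounded above, so its
    supremum dominates each feasible value. *)
Lemma delta_feasible_le (kappa c amax zu zv alpha gamma : K) :
  0 <= kappa < 1 -> 0 <= c < 1 -> delta_feasible c amax zu zv alpha gamma ->
  4^-1 * ((kappa * zu + zv) ^+ 2 + gamma ^+ 2) <= delta kappa c amax ^+ 2.
Proof.
move=> k01 c01 feas.
set t := leLHS.
have t0 : 0 <= t by rewrite mulr_ge0 ?invr_ge0 ?ler0n ?addr_ge0 ?sqr_ge0.
set S := [set t | exists zu zv alpha gamma : K,
    delta_feasible c amax zu zv alpha gamma /\
    t = 4^-1 * ((kappa * zu + zv) ^+ 2 + gamma ^+ 2)].
have tS : t <= sup S.
  apply: ub_le_sup; last by exists zu, zv, alpha, gamma.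
  exists (1 - (1 - kappa) * (1 - c ^+ 2) / 16).
  by move=> _ [? [? [? [? [? ->]]]]]; apply: delta_objective_bound; eauto.
by rewrite /delta sqr_sqrtr //; apply: le_trans tS.
Qed.

End ContractionFactor.

(** * Splitting along the range of [A^T] and the null space of [A] *)

Section OrthogonalSplitting.
Variables (K : realType) (m n p : nat).
Variables (A : 'M[K]_(m, n)) (R : 'M[K]_(n, m)) (Z : 'M[K]_(n, p)).
Hypotheses (Rbasis : orthonormal_basis R A)
  (Zbasis : orthonormal_basis Z (kermx A^T)).

(** [kermx] is a left kernel: the rows of [Z^T] span the [r] with [r *m A^T = 0], the transposed
    null vectors of [A]. *)
Lemma null_basis_mul : A *m Z = 0.
Proof.
apply: trmx_inj; rewrite trmx0 trmx_mul; apply/sub_kermxP.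
by rewrite -Zbasis.2.
Qed.

Lemma range_null_orth : R^T *m Z = 0.
Proof.
have /submxP[X ->] : (R^T <= A)%MS by rewrite Rbasis.2.
by rewrite -mulmxA null_basis_mul mulmx0.
Qed.

Lemma range_projector : A *m R *m R^T = A.
Proof.
have /submxP[X ->] : (A <= R^T)%MS by rewrite Rbasis.2.
by rewrite -(mulmxA X) Rbasis.1 mulmx1.
Qed.

(** The defect [P] is symmetric with [A P = 0], so its rows lie in the span of [Z^T] and
    [P = D Z^T]; then [P Z = 0] forces [D = 0]. *)
Lemma orthogonal_resolution : R *m R^T + Z *m Z^T = 1%:M.
Proof.
pose P : 'M[K]_n := 1%:M - (R *m R^T + Z *m Z^T).
have Psym : P^T = P.
  by rewrite /P linearB linearD /= trmx1 !trmx_mul !trmxK.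
have AP : A *m P = 0.
  rewrite /P mulmxBr mulmx1 mulmxDr !mulmxA range_projector null_basis_mul.
  by rewrite mul0mx addr0 subrr.
have /submxP[D PD] : (P <= Z^T)%MS.
  by rewrite Zbasis.2; apply/sub_kermxP; rewrite -Psym -trmx_mul AP trmx0.
have PZ : P *m Z = 0.
  rewrite /P mulmxBl mul1mx mulmxDl -!mulmxA range_null_orth Zbasis.1.
  by rewrite mulmx0 add0r mulmx1 subrr.
have D0 : D = 0 by rewrite -PZ PD -mulmxA Zbasis.1 mulmx1.
by apply/esym/eqP; rewrite -subr_eq0 -/P PD D0 mul0mx.
Qed.

(** Since [A R R^T = A], the rank of [A R] is at least that of [A]. *)
Lemma unitmx_mul_range_basis : \rank A = m -> A *m R \in unitmx.
Proof.
move=> rA; rewrite -row_free_unit /row_free eqn_leq rank_leq_row /=.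
by rewrite -[leqLHS]rA -[in leqLHS]range_projector mxrankM_maxl.
Qed.

Lemma dotcv_split (x : 'cV[K]_n) :
  dotcv x x = dotcv (R^T *m x) (R^T *m x) + dotcv (Z^T *m x) (Z^T *m x).
Proof.
by rewrite !dotcv_mulmxl -dotcvDr !mulmxA -mulmxDl orthogonal_resolution mul1mx.
Qed.

(** One step of the iteration, normalized so that the component norms are themselves the variables
    of the problem defining [delta]. *)
Lemma reflected_step_le (B : 'M[K]_p) (c : K) (dw dl : 'cV[K]_n) :
  specnorm B < 1 -> 0 <= c < 1 -> dotcv dw dl <= 0 ->
  l2norm (R^T *m dl) <= c * l2norm dl -> l2norm (dw - dl) = 1 ->
  l2norm (2^-1 *: ((Z *m B *m Z^T - R *m R^T) *m (dw + dl) + (dw - dl)))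
    <= delta (specnorm B) c (l2norm dl).
Proof.
move=> B1 c01 wl Rdl v1.
set u := dw + dl; set v := dw - dl in v1 *.
have dlE : u - v = 2 *: dl.
  by apply/colP => i; rewrite /u /v !mxE; ring.
(* [|u|^2 = |v|^2 + 4 dw^T dl]. *)
have uv : dotcv u u <= 1.
  rewrite -[leRHS](expr1n _ 2) -v1 sqr_l2norm /u /v !dotcv_linear (dotcvC dl).
  lra.
have vv : dotcv v v = 1 by rewrite -sqr_l2norm v1 expr1n.
have split_le x : dotcv x x <= 1 ->
    l2norm (R^T *m x) <= Num.sqrt (1 - l2norm (Z^T *m x) ^+ 2) /\
    0 <= l2norm (Z^T *m x) <= 1.
  rewrite dotcv_split => x1; split.
    by rewrite l2normE ler_wsqrtr // sqr_l2norm; lra.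
  rewrite l2norm_ge0 -(ler_pXn2r (n := 2)) ?nnegrE ?l2norm_ge0 ?ler01 //.
  rewrite expr1n sqr_l2norm; have := dotcv_ge0 (R^T *m x); lra.
have [Ru zu01] := split_le u uv.
have [Rv zv01] := split_le v ltac:(by rewrite vv).
(* The triangle inequality for [2 dl = u - v]. With [S = Z] it yields the first feasibility
   constraint, with [S = R] the third. *)
have diff_le (q : nat) (S : 'M[K]_(n, q)) :
    2 * l2norm (S^T *m dl) <= l2norm (S^T *m u) + l2norm (S^T *m v).
  rewrite -l2normZ ?ler0n // scalemxAr -dlE mulmxBr -(l2normN (S^T *m v)).
  exact: l2norm_triangle.
have feas : delta_feasible c (l2norm dl) (l2norm (Z^T *m u))
    (l2norm (Z^T *m v)) (l2norm dl) (2 * l2norm (R^T *m dl)).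
  have Rdl2 : l2norm (R^T *m dl) ^+ 2 <= c ^+ 2 * l2norm dl ^+ 2.
    rewrite -exprMn ler_pXn2r ?nnegrE ?l2norm_ge0 //.
    by rewrite mulr_ge0 ?l2norm_ge0 //; case/andP: c01.
  split=> //; last by rewrite l2norm_ge0 lexx.
  - have : (2 * l2norm (Z^T *m dl)) ^+ 2
        <= (l2norm (Z^T *m u) + l2norm (Z^T *m v)) ^+ 2.
      by rewrite ler_pXn2r ?nnegrE ?addr_ge0 ?mulr_ge0 ?l2norm_ge0 ?ler0n.
    apply: le_trans; rewrite exprMn.
    move: Rdl2; rewrite !sqr_l2norm (dotcv_split dl); lra.
  - by rewrite exprMn; lra.
  - rewrite ler_pXn2r ?nnegrE ?addr_ge0 ?sqrtr_ge0 ?mulr_ge0 ?l2norm_ge0 //.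
    by apply: le_trans (diff_le _ R) _; apply: lerD.
have d0 : 0 <= delta (specnorm B) c (l2norm dl) by exact: sqrtr_ge0.
rewrite -(ler_pXn2r (n := 2)) ?nnegrE ?l2norm_ge0 //.
have B01 : 0 <= specnorm B < 1 by rewrite specnorm_ge0 B1.
apply: le_trans (delta_feasible_le B01 c01 feas).
set x := _ *m u + v.
(* The reflected matrix acts as [B] on the range of [Z] and as [-1] on the range of [R], where only
   [v - u = - 2 dl] is left. *)
have Zx : Z^T *m x = B *m (Z^T *m u) + Z^T *m v.
  rewrite /x mulmxDr mulmxA mulmxBr !mulmxA Zbasis.1 mul1mx.
  have -> : Z^T *m R = 0.
    by apply: trmx_inj; rewrite trmx_mul trmxK range_null_orth trmx0.
  by rewrite mul0mx subr0.
have Rx : R^T *m x = - (2 *: (R^T *m dl)).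
  rewrite /x mulmxDr mulmxA mulmxBr !mulmxA Rbasis.1 mul1mx range_null_orth.
  by rewrite !mul0mx sub0r mulNmx scalemxAr -dlE [in RHS]mulmxBr opprB addrC.
rewrite l2normZ ?invr_ge0 ?ler0n // exprMn sqr_l2norm dotcv_split Zx Rx.
rewrite -!sqr_l2norm l2normN l2normZ ?ler0n //.
have : l2norm (B *m (Z^T *m u) + Z^T *m v) ^+ 2
    <= (specnorm B * l2norm (Z^T *m u) + l2norm (Z^T *m v)) ^+ 2.
  rewrite ler_pXn2r ?nnegrE ?addr_ge0 ?mulr_ge0 ?l2norm_ge0 ?specnorm_ge0 //.
  by apply: le_trans (l2norm_triangle _ _) _; rewrite lerD2r l2norm_mulmx_le.
lra.
Qed.

End OrthogonalSplitting.

(** * Unit columns and the angle between the range of [R] and the active coordinates *)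

Section UnitColumns.
Variables (K : realType) (n : nat) (S : {set 'I_n}).
Local Notation E := (unit_cols K S).

Lemma unit_cols_orthonormal : E^T *m E = 1%:M.
Proof.
apply/matrixP => i j; rewrite !mxE (bigD1 (enum_val i)) //= !mxE eqxx mul1r.
rewrite big1 => [|l li]; last by rewrite !mxE (negPf li) mul0r.
by rewrite addr0 (inj_eq enum_val_inj).
Qed.

Lemma dotcv_unit_cols (x : 'cV[K]_#|S|) : dotcv (E *m x) (E *m x) = dotcv x x.
Proof.
by rewrite -dotcv_mulmxl mulmxA unit_cols_orthonormal mul1mx.
Qed.

Lemma unit_cols_supported (x : 'cV[K]_n) :
  (forall i, x i 0 != 0 -> i \in S) -> E *m (E^T *m x) = x.
Proof.
move=> xS; apply/colP => i.
have Ex (j : 'I_#|S|) : (E^T *m x) j 0 = x (enum_val j) 0.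
  rewrite mxE (bigD1 (enum_val j)) //= !mxE eqxx mul1r big1 ?addr0 // => l lj.
  by rewrite !mxE (negPf lj) mul0r.
rewrite mxE; have [iS|niS] := boolP (i \in S); last first.
  have /eqP-> : x i 0 == 0 by apply: contraNT niS => /xS.
  rewrite big1 // => j _; rewrite mxE.
  have -> : (i == enum_val j) = false.
    by apply: contraNF niS => /eqP->; exact: enum_valP.
  by rewrite mul0r.
rewrite (bigD1 (enum_rank_in iS i)) //= Ex !mxE enum_rankK_in // eqxx mul1r.
rewrite big1 ?addr0 // => j ji; rewrite mxE.
have -> : (i == enum_val j) = false.
  apply: contraNF ji => /eqP ij.
  by apply/eqP/enum_val_inj; rewrite enum_rankK_in.
by rewrite mul0r.
Qed.

End UnitColumns.

(** Equality of norms at some [x != 0] would give [Z^T E x = 0], placing [E x] in the range of [R]: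
    a linear dependence among the columns of [row_mx R E]. *)
Lemma specnorm_range_unit_cols_lt1 (K : realType) (m n p : nat)
    (A : 'M[K]_(m, n)) (R : 'M[K]_(n, m)) (Z : 'M[K]_(n, p)) (S : {set 'I_n}) :
  orthonormal_basis R A -> orthonormal_basis Z (kermx A^T) ->
  \rank (row_mx R (unit_cols K S)) = (m + #|S|)%N ->
  specnorm (R^T *m unit_cols K S) < 1.
Proof.
move=> Rb Zb rk; set E := unit_cols K S; apply: specnorm_lt1 => x x0.
rewrite -(dotcv_unit_cols x) (dotcv_split Rb Zb) -/E mulmxA ltrDl.
rewrite lt_def dotcv_ge0 andbT dotcv_eq0; apply: contra x0 => /eqP ZEx.
have ExR : R *m (R^T *m (E *m x)) = E *m x.
  rewrite -[RHS]mul1mx -(orthogonal_resolution Rb Zb) mulmxDl -!mulmxA ZEx.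
  by rewrite mulmx0 addr0.
pose W := row_mx R E; pose t := col_mx (- (R^T *m (E *m x))) x.
have Wt : W *m t = 0 by rewrite mul_row_col mulmxN ExR addNr.
have : row_free W^T by rewrite /row_free mxrank_tr rk.
move/row_free_inj/(_ t^T 0); rewrite -trmx_mul Wt trmx0 mul0mx => /(_ erefl).
move/eqP; rewrite trmx_eq0 col_mx_eq0; by case/andP.
Qed.

(** * The matrices of the [y]-update and its fixed point *)

Section IterationMatrices.
Variables (K : realType) (m n p : nat) (Q : 'M[K]_n) (A : 'M[K]_(m, n)).
Variables (R : 'M[K]_(n, m)) (Z : 'M[K]_(n, p)) (beta : K).
Hypotheses (beta_gt0 : 0 < beta) (Rbasis : orthonormal_basis R A)
  (Zbasis : orthonormal_basis Z (kermx A^T))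
  (ZQZ_pd : posdef (Z^T *m Q *m Z)).

Local Notation H := (beta^-1 *: (Z^T *m Q *m Z) + 1%:M).

(** Reconciles, through [Z^T Z = 1], the matrices inverted in [admm_M] and in [admm_MZ]. *)
Lemma reduced_hessianE : Z^T *m (beta^-1 *: Q + 1%:M) *m Z = H.
Proof.
by rewrite mulmxDr mulmxDl mulmx1 Zbasis.1 -scalemxAr -scalemxAl.
Qed.

Lemma reduced_hessian_unitmx : H \in unitmx.
Proof.
apply: posdef_unitmx => x x0; rewrite mulmxDl mul1mx dotcvDr -scalemxAl dotcvZr.
rewrite addr_gt0 ?mulr_gt0 ?invr_gt0 ?ZQZ_pd //.
by rewrite lt_def dotcv_ge0 dotcv_eq0 x0.
Qed.

(* With [S = Z^T Q Z / beta] and [x = (S + 1) t] one has [MZ x = (1 - S) t],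
   so [|x|^2 - |MZ x|^2 = 4 t^T S t]. *)
Lemma specnorm_admm_MZ_lt1 : specnorm (admm_MZ Q Z beta) < 1.
Proof.
apply: specnorm_lt1 => x x0; have Hu := reduced_hessian_unitmx.
have [t xt] : exists t, x = H *m t by exists (invmx H *m x); rewrite mulKVmx.
have t0 : t != 0 by apply: contra x0 => /eqP t0; rewrite xt t0 mulmx0.
have -> : admm_MZ Q Z beta *m x = 2 *: t - x.
  by rewrite /admm_MZ mulmxBl mul1mx -scalemxAl {1}xt mulKmx.
have : 0 < beta^-1 * dotcv t (Z^T *m Q *m Z *m t).
  by rewrite mulr_gt0 ?invr_gt0 ?ZQZ_pd.
rewrite -dotcvZr scalemxAl xt mulmxDl mul1mx.
set s := _ *m t; rewrite !dotcv_linear (dotcvC s t); lra.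
Qed.

Lemma admm_M_reflection :
  2 *: admm_M Q Z beta - 1%:M = Z *m admm_MZ Q Z beta *m Z^T - R *m R^T.
Proof.
rewrite -(orthogonal_resolution Rbasis Zbasis) /admm_M /admm_MZ.
rewrite reduced_hessianE mulmxBr mulmxBl mulmx1 -scalemxAr -scalemxAl.
by rewrite opprD addrA addrAC.
Qed.

(** Split [ys = r + z] along the ranges of [R] and [Z]. The [N b] term supplies
    [r - M (Q / beta) r], while [M] inverts [Q / beta + 1] on [z] and kills [r]. *)
Lemma kkt_fixed_point (q ys lams : 'cV[K]_n) (b xi : 'cV[K]_m) :
  \rank A = m -> Q *m ys + A^T *m xi - lams = - q -> A *m ys = b ->
  admm_M Q Z beta *m (ys + beta^-1 *: lams - beta^-1 *: q)
    + admm_N Q A R Z beta *m b = ys.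
Proof.
move=> rA kkt <-; have ARu := unitmx_mul_range_basis Rbasis rA.
have ZA : Z^T *m A^T = 0 by rewrite -trmx_mul (null_basis_mul Zbasis) trmx0.
have ZR : Z^T *m R = 0.
  apply: trmx_inj.
  by rewrite trmx_mul trmxK (range_null_orth Rbasis Zbasis) trmx0.
pose r := R *m (R^T *m ys); pose z := Z *m (Z^T *m ys).
have ysE : ys = r + z.
  rewrite /r /z !mulmxA -mulmxDl.
  by rewrite (orthogonal_resolution Rbasis Zbasis) mul1mx.
have Nb : admm_N Q A R Z beta *m (A *m ys)
    = r - admm_M Q Z beta *m ((beta^-1 *: Q) *m r).
  have -> : A *m ys = A *m R *m (R^T *m ys).
    by rewrite mulmxA (range_projector Rbasis).
  rewrite /admm_N -(mulmxA _ _ (A *m R *m _)) mulKmx // -mulmxA -/r.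
  by rewrite mulmxBl mul1mx -!mulmxA.
(* Stationarity turns the argument into [(Q / beta + 1) ys + A^T xi / beta], and [Z^T] removes the
   equality multiplier. *)
have Zdual : Z^T *m (ys + beta^-1 *: lams - beta^-1 *: q)
    = Z^T *m ((beta^-1 *: Q + 1%:M) *m ys).
  have -> : ys + beta^-1 *: lams - beta^-1 *: q
      = (beta^-1 *: Q + 1%:M) *m ys + beta^-1 *: (A^T *m xi).
    rewrite -addrA -scalerBr mulmxDl mul1mx -scalemxAl addrC addrAC -scalerDr.
    by congr (_ *: _ + _); rewrite -kkt addrC subrK.
  by rewrite mulmxDr -scalemxAr !mulmxA ZA mul0mx scaler0 addr0.
have Mz : admm_M Q Z beta *m ((beta^-1 *: Q + 1%:M) *m z) = z.
  rewrite /admm_M reduced_hessianE -2!mulmxA /z.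
  have -> : Z^T *m ((beta^-1 *: Q + 1%:M) *m (Z *m (Z^T *m ys)))
      = H *m (Z^T *m ys).
    by rewrite -reduced_hessianE !mulmxA.
  by rewrite mulKmx // reduced_hessian_unitmx.
have Mr : admm_M Q Z beta *m r = 0.
  by rewrite /admm_M /r -(mulmxA _ Z^T) (mulmxA Z^T) ZR mul0mx mulmx0.
rewrite Nb {1}/admm_M -(mulmxA _ Z^T) Zdual mulmxA -/(admm_M Q Z beta).
rewrite [in LHS]ysE mulmxDr mulmxDr Mz.
rewrite mulmxDl mul1mx mulmxDr Mr addr0.
by rewrite [RHS]ysE (addrC _ z) addrACA subrr addr0 addrC.
Qed.

End IterationMatrices.

(** * Contraction of the iteration *)

Theorem theorem1 (K : realType) (m n : nat)
    (Q : 'M[K]_n) (q : 'cV[K]_n) (A : 'M[K]_(m, n)) (b : 'cV[K]_m)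
    (lo up : 'I_n -> \bar K)
    (R : 'M[K]_(n, m)) (Z : 'M[K]_(n, n - m)) (beta : K)
    (ys lams : 'cV[K]_n) (y w lam : nat -> 'cV[K]_n)
    (Qsym : Q^T = Q) (Qpsd : possemidef Q)
    (lo_lt_up : forall i, (lo i < up i)%E)
    (beta_gt0 : 0 < beta)
    (Rbasis : orthonormal_basis R A)
    (Zbasis : orthonormal_basis Z (kermx A^T))
    (Yneq0 : box lo up !=set0)
    (Afull : \rank A = m)
    (ZQZ_pd : posdef (Z^T *m Q *m Z))
    (sol : qp_solution Q q A b (box lo up) ys lams)
    (REfull : \rank (row_mx R (unit_cols K (active lo up ys)))
              = (m + #|active lo up ys|)%N)
    (iter : admm_iteration Q q A b (box lo up) R Z beta y w lam) :
  forall k : nat, active_iter beta lams lam k \subset active lo up ys ->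
    let v := admm_v y lam in
    let vs := vstar beta ys lams in
    let alpha := alpha_iter beta ys lams y lam in
    let cF := specnorm (R^T *m unit_cols K (active lo up ys)) in
    let d := delta (specnorm (admm_MZ Q Z beta)) cF (alpha k) in
    [/\ l2norm (v k.+1 - vs) <= d * l2norm (v k - vs),
        d < 1
      & alpha k <= 1].
Proof.
move=> k sub_active v vs alpha cF d.
have kappa1 : specnorm (admm_MZ Q Z beta) < 1.
  exact: specnorm_admm_MZ_lt1.
have kappa01 : 0 <= specnorm (admm_MZ Q Z beta) < 1 by rewrite specnorm_ge0.
have cF01 : 0 <= cF < 1.
  by rewrite specnorm_ge0; apply: specnorm_range_unit_cols_lt1 Rbasis Zbasis _.
have [xi [kkt Ays [ysY lamsVI]]] := sol.
have [_ wk lamk] := iter k; have [yk1 _ _] := iter k.+1.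
pose dw := w k.+1 - ys; pose dl := lam k.+1 - beta^-1 *: lams.
(* The multiplier update shifts the index, so [v k] depends on step [k.+1] alone. *)
have vkE : v k = w k.+1 - lam k.+1.
  by rewrite /v /admm_v lamk; apply/colP => i; rewrite !mxE; ring.
have dvE : v k - vs = dw - dl.
  by rewrite vkE /vs /vstar /dw /dl; apply/colP => i; rewrite !mxE; ring.
have [wY wVI] := proj_box_variational (v k) lo_lt_up Yneq0.
rewrite -[Defs.proj _ _]wk in wY wVI.
(* Add the projection inequality at [ys], where [v k - w k.+1 = - lam k.+1], to the optimality
   inequality at [w k.+1] scaled by [beta^-1]. *)
have wl : dotcv dw dl <= 0.
  have := wVI ys ysY; have := lamsVI (w k.+1) wY.
  rewrite -(pmulr_rge0 _ (_ : 0 < beta^-1)) ?invr_gt0 //.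
  rewrite vkE /dw /dl !dotcv_linear.
  rewrite !(dotcvC _ lams) !(dotcvC _ (lam k.+1)); lra.
have norm_dv := dotcv_subsub dw dl.
have dv1E : v k.+1 - vs = 2^-1 *: ((Z *m admm_MZ Q Z beta *m Z^T - R *m R^T)
    *m (dw + dl) + (dw - dl)).
  rewrite -(admm_M_reflection Q beta Rbasis Zbasis) mulmxBl mul1mx -scalemxAl.
  (* Subtracting the fixed-point equation from the next [y]-update cancels [q] and [b]. *)
  have -> : admm_M Q Z beta *m (dw + dl) = y k.+2 - ys.
    have fixed := kkt_fixed_point beta_gt0 Rbasis Zbasis ZQZ_pd Afull kkt Ays.
    apply: (addIr ys); rewrite subrK yk1 -[X in _ + X = _]fixed addrA -mulmxDr.
    congr (_ *m _ + _).
    by rewrite /dw /dl; apply/colP => i; rewrite !mxE; ring.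
  rewrite /v /admm_v /vs /vstar /dw /dl; apply/colP => i; rewrite !mxE.
  by field; rewrite gt_eqF.
(* The inclusion of active sets enters here: [dl] is supported on the active coordinates, so
   [dl = E E^T dl] and [|E^T dl| = |dl|]. *)
have Rdl : l2norm (R^T *m dl) <= cF * l2norm dl.
  set E := unit_cols K (active lo up ys).
  have dlE : E *m (E^T *m dl) = dl.
    apply: unit_cols_supported => i dli; apply: (fintype.subsetP sub_active).
    by move: dli; rewrite inE !mxE subr_eq0 [_ / _]mulrC.
  rewrite -{1}dlE mulmxA; apply: le_trans (l2norm_mulmx_le _ _) _.
  by rewrite !l2normE -dotcv_unit_cols dlE.
have alpha01 : 0 <= alpha k <= 1.
  rewrite /alpha /alpha_iter -/v -/vs; case: eqP => [_|/eqP nv].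
    by rewrite lexx ler01.
  have dv0 : 0 < l2norm (v k - vs).
    by rewrite lt_def l2norm_ge0 l2norm_eq0 subr_eq0 nv.
  rewrite divr_ge0 ?l2norm_ge0 //= ler_pdivrMr // mul1r !l2normE ler_wsqrtr //.
  by rewrite dvE norm_dv -/dl; have := dotcv_ge0 dw; lra.
case/andP: (alpha01) => alpha0 alpha1; split=> //; last exact: delta_lt1.
(* Normalization fails when [v k = vs]; then [|dw|^2 + |dl|^2 = 2 dw^T dl <= 0], so the iteration is
   already at its fixed point. *)
have [vkvs|nv] := eqVneq (v k) vs.
  have dv0 : dotcv (dw - dl) (dw - dl) = 0.
    by apply/eqP; rewrite dotcv_eq0 -dvE vkvs subrr.
  rewrite dv0 in norm_dv.
  have dw0 : dw = 0.
    apply/eqP; rewrite -dotcv_eq0 eq_le dotcv_ge0 andbT.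
    have := dotcv_ge0 dl; lra.
  have dl0 : dl = 0.
    apply/eqP; rewrite -dotcv_eq0 eq_le dotcv_ge0 andbT.
    have := dotcv_ge0 dw; lra.
  rewrite dv1E dw0 dl0 subrr !addr0 mulmx0 scaler0 vkvs subrr.
  by have /eqP-> : l2norm (0 : 'cV[K]_n) == 0; rewrite ?l2norm_eq0 // mulr0.
set s := l2norm (v k - vs).
have s0 : 0 < s by rewrite lt_def l2norm_ge0 l2norm_eq0 subr_eq0 nv.
have si0 : 0 <= s^-1 by rewrite invr_ge0 ltW.
rewrite -ler_pdivrMr // mulrC -l2normZ //.
(* The step is linear in [dw] and [dl], so both can be divided by [s]; the norm of the scaled [dl]
   is then [alpha k]. *)
have -> : s^-1 *: (v k.+1 - vs) = 2^-1 *: ((Z *m admm_MZ Q Z beta *m Z^T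
    - R *m R^T) *m (s^-1 *: dw + s^-1 *: dl) + (s^-1 *: dw - s^-1 *: dl)).
  rewrite dv1E scalerA mulrC -scalerA -(scalerDr _ dw) -scalerBr -scalemxAr.
  by rewrite -scalerDr.
rewrite /d /alpha /alpha_iter -/v -/vs (negPf nv) -/dl -/s mulrC -l2normZ //.
apply: (reflected_step_le Rbasis Zbasis) => //.
- by rewrite dotcvZl dotcvZr !mulr_ge0_le0.
- by rewrite -scalemxAr !l2normZ // mulrCA ler_wpM2l.
- by rewrite -scalerBr l2normZ // -dvE mulVf // gt_eqF.
Qed.
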